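(* Let $k$ be a field, $R=k[x_1,\dots,x_n]$, and let $a\ge b\ge 1$ be integers. Suppose $J,K\subseteq[n]=\{1,\dots,n\}$ are such that $J\cap K$, $J\setminus K$, $K\setminus J$ are all nonempty. Set $A=J\setminus K$, $B=K\setminus J$, $C=J\cap K$ and $$U=\mathfrak m_C^{a}+\mathfrak m_A\mathfrak m_C^{a-1}+\cdots+\mathfrak m_A^{a-b}\mathfrak m_C^{b},$$ $$V=\mathfrak m_B\mathfrak m_A^{a-b+1}\mathfrak m_C^{b-1}+\mathfrak m_B^2\mathfrak m_A^{a-b+2}\mathfrak m_C^{b-2}+\cdots+\mathfrak m_B^{b}\mathfrak m_A^{a}.$$ If $I=\mathfrak m_J^{a}\cap\mathfrak m_K^{b}$, then for all $i\ge 0$ \begin{align*} \beta_{i,i+a}(I)&=\beta_{i,i+a}(U),\\ \beta_{i,i+a+1}(I)&=\beta_{i,i+a+1}(V)+\beta_{i-1,i+a+1}(\mathfrak m_B\mathfrak m_A^{a-b+1}\mathfrak m_C^{b}),\\ \beta_{i,i+a+j}(I)&=\beta_{i,i+a+j}(V)\quad\text{for } j=2,\dots,b. \end{align*}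
   Context: For a nonempty subset $J=\{j_1,\dots,j_t\}\subseteq[n]$, $\mathfrak m_J=(x_{j_1},\dots,x_{j_t})\subset R$; a zeroth power of an ideal is $R$. $R$ is standard graded, and $\beta_{i,j}(I)$ denotes the $(i,j)$-th graded Betti number of the ideal $I$ regarded as an $R$-module, i.e. the number of copies of $R(-j)$ in homological degree $i$ of the minimal graded free resolution $\cdots\to F_1\to F_0\to I\to 0$; $\beta_{-1,j}=0$. *)

(* Defs.v *)
From mathcomp Require Import all_boot all_order all_algebra.
From mathcomp Require Import classical_sets mpoly.
(* classical_sets shadows set0, setT, ...: re-import finset so that the short
   names denote finite sets; sets of polynomials are in scope %classic. *)
From mathcomp Require Import finset.

Set Implicit Arguments.
Unset Strict Implicit.
Unset Printing Implicit Defensive.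

Import GRing.Theory.
Local Open Scope ring_scope.

Section Ideals.
Context {k : fieldType} {n : nat}.
Local Notation R := {mpoly k[n]}.
Implicit Types S I J : set R.

Definition ideal_gen S : set R :=
  [set f | exists (m : nat) (c s : 'I_m -> R),
     (forall i, S (s i)) /\ f = \sum_(i < m) c i * s i]%classic.

Definition ideal_add I J : set R := [set f + g | f in I & g in J]%classic.

Definition ideal_mul I J : set R :=
  ideal_gen [set f * g | f in I & g in J]%classic.

Definition ideal_exp I (e : nat) : set R :=
  iter e (ideal_mul I) classical_sets.setT.

Definition var_ideal (A : {set 'I_n}) : set R :=
  ideal_gen [set 'X_j | j in [set` A]]%classic.

End Ideals.

Section GradedResolutions.
Context {k : fieldType} {n : nat}.
Local Notation R := {mpoly k[n]}.

(* Data for a chain of maps ... -> F_1 -> F_0 -> R, where F_i is the direct sum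
   of the R(- gshift i p), p < grank i. Elements of F_i are row vectors and maps
   act by right multiplication: gdiff i is F_{i+1} -> F_i, gaug is F_0 -> R.
   Shifts in nat are enough for ideals of R, which live in degrees >= 0. *)
Record graded_free_chain := GradedFreeChain {
  grank  : nat -> nat;
  gshift : forall i, 'I_(grank i) -> nat;
  gdiff  : forall i, 'M[R]_(grank i.+1, grank i);
  gaug   : 'cV[R]_(grank 0) }.

(* Multiplication by f is a degree-0 map R(-s) -> R(-t). *)
Definition degree0_entry (s t : nat) (f : R) : bool :=
  if (t <= s)%N then f \is (s - t)%N.-homog else f == 0.

Definition graded_chain (F : graded_free_chain) : Prop :=
  (forall p, degree0_entry (gshift p) 0 (gaug F p 0)) /\
  (forall i p q, degree0_entry (gshift p) (gshift q) (gdiff F i p q)).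

(* Exactness of ... -> F_1 -> F_0 -> I -> 0. *)
Definition resolves (F : graded_free_chain) (I : set R) : Prop :=
  [/\ forall f, I f <-> exists v : 'rV[R]_(grank F 0), v *m gaug F = f%:M,
      forall v : 'rV[R]_(grank F 0),
        v *m gaug F = 0 <-> exists w, v = w *m gdiff F 0
    & forall i (v : 'rV[R]_(grank F i.+1)),
        v *m gdiff F i = 0 <-> exists w, v = w *m gdiff F i.+1].

(* F_{i+1} maps into (x_1, ..., x_n) F_i. *)
Definition minimal_chain (F : graded_free_chain) : Prop :=
  forall i p q, var_ideal [set: 'I_n] (gdiff F i p q).

Definition minimal_graded_free_resolution (F : graded_free_chain)
    (I : set R) : Prop :=
  [/\ graded_chain F, resolves F I & minimal_chain F].

(* The number of summands R(-j) of F_i. *)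
Definition gcount (F : graded_free_chain) (i j : nat) : nat :=
  #|[set p : 'I_(grank F i) | gshift p == j]|.

(* The minimal graded free resolution exists for every homogeneous ideal and is
   unique up to isomorphism, so the number chosen here is the only candidate;
   the default 0 concerns only sets that are not homogeneous ideals. *)
Definition betti (i j : nat) (I : set R) : nat :=
  xget 0%N [set c | exists F : graded_free_chain,
    minimal_graded_free_resolution F I /\ c = gcount F i j]%classic.

End GradedResolutions.

(* Main.v *)
Require Import Defs.
From mathcomp Require Import all_boot all_order all_algebra.
From mathcomp Require Import boolp classical_sets mpoly.
From mathcomp Require Import finset zify.

(* Everything is built from one mapping cone. If P and Q have minimal graded
   free resolutions whose i-th shifts lie in [i + lo, i + hi], and the i-th shifts
   for P `&` Q all equal i + hi + 1, then the graded lifts of P `&` Q <= P and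
   P `&` Q <= Q have entries of positive degree, so the cone of
   0 -> P `&` Q -> P (+) Q -> P + Q -> 0 is a minimal resolution of P + Q, with
   shifts in [i + lo, i + hi], and the Betti numbers add up:
     betti_i (P + Q) = betti_i P + betti_i Q + betti_(i-1) (P `&` Q).
   This applies to
   - m_A^p N = m_A'^p N + x m_A^(p-1) N where A = {x} :|: A' and N does not
     involve the variables of A; hence m_B^q m_A^p m_C^r has a linear resolution;
   - U, one summand at a time;
   - V = V_1 + ... + V_b with V_t = m_B^t m_A^(a-b+t) m_C^(b-t), where
     (V_1 + ... + V_(t-1)) `&` V_t = m_C V_t for t >= 2;
   - I = U + V_1 + ... + V_b, where (U + V_1 + ... + V_(t-1)) `&` V_t = m_C V_t
     for t >= 1.
   Comparing the last two, betti_i I = betti_i U + betti_i V + betti_(i-1) W with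
   W = m_C V_1, and U, V, W live in degrees i + a, [i + a + 1, i + a + b] and
   i + a + 2. *)

Set Implicit Arguments.
Unset Strict Implicit.
Unset Printing Implicit Defensive.

Import GRing.Theory.
Local Open Scope ring_scope.

(** * Monomial ideals as predicates on exponents *)

Section MonomialIdeals.
Context {k : fieldType} {n : nat}.
Local Notation R := {mpoly k[n]}.
Implicit Types (f g : R) (D E : pred 'X_{1..n}) (A B : {set 'I_n}).

(** Encoding by supports turns sums, intersections and products of ideals into statements about
    exponents, which [lia] decides once they are expressed through [mdeg_in]. The set is an ideal
    when [D] is upward closed. *)
Definition mon_ideal D : set R := [set f | forall m, f@_m != 0 -> D m]%classic.

Definition upward_closed D := forall m m', D m -> D (m + m')%MM.

Definition mdeg_in A (m : 'X_{1..n}) : nat := (\sum_(j in A) m j)%N.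

Definition mrestrict D f : R := \sum_(m <- msupp f | D m) f@_m *: 'X_[m].

Lemma mcoeff_mrestrict D f m : (mrestrict D f)@_m = if D m then f@_m else 0.
Proof.
rewrite /mrestrict raddf_sum /=.
under eq_bigr do rewrite mcoeffZ mcoeffX.
have [mf|mf] := boolP (m \in msupp f); last first.
  rewrite (memN_msupp_eq0 mf) if_same big1_seq // => i /andP[_ i_f].
  by case: eqP => [im|_]; rewrite ?mulr0 // -im i_f in mf *.
rewrite big_mkcond (bigD1_seq m) //= big1 => [|i /negPf ->].
  by rewrite eqxx mulr1 addr0.
by rewrite mulr0 if_same.
Qed.

Lemma mcoeffM_neq0 f g m : (f * g)@_m != 0 ->
  exists m1 m2, [/\ m = (m1 + m2)%MM, f@_m1 != 0 & g@_m2 != 0].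
Proof.
move=> fgm; have /msuppM_le/allpairsP[[m1 m2] /= [fm1 gm2 ->]] : m \in msupp (f * g).
  by rewrite mcoeff_msupp.
by exists m1, m2; rewrite -!mcoeff_msupp.
Qed.

Lemma mon_ideal0 D : mon_ideal D 0.
Proof. by move=> m; rewrite mcoeff0 eqxx. Qed.

Lemma mon_idealD D f g : mon_ideal D f -> mon_ideal D g -> mon_ideal D (f + g).
Proof.
move=> Df Dg m; rewrite mcoeffD; have [fm0|fm _] := eqVneq f@_m 0.
  by rewrite fm0 add0r; apply: Dg.
exact: Df.
Qed.

Lemma mon_idealM D f g : upward_closed D -> mon_ideal D g -> mon_ideal D (f * g).
Proof.
move=> upD Dg m /mcoeffM_neq0[m1 [m2 [-> _ gm2]]].
by rewrite addmC; apply/upD/Dg.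
Qed.

Lemma mon_ideal_sum D m (c s : 'I_m -> R) : upward_closed D ->
  (forall i, mon_ideal D (s i)) -> mon_ideal D (\sum_(i < m) c i * s i).
Proof.
move=> upD Ds; elim/big_rec: _ => [|i f _ Df]; first exact: mon_ideal0.
exact/mon_idealD/Df/mon_idealM/Ds.
Qed.

Lemma mon_idealX D m : mon_ideal D 'X_[m] <-> D m.
Proof.
split=> [DX|Dm m']; first by apply: DX; rewrite mcoeffX eqxx; apply: oner_neq0.
by rewrite mcoeffX; have [<-//|_] := eqVneq m m'; rewrite eqxx.
Qed.

(** A polynomial with support in [D] is the sum of its terms, and each of them is a multiple of a
    monomial in [S]. *)
Lemma ideal_genE D (S : set R) : upward_closed D ->
    (forall s, S s -> mon_ideal D s) ->
    (forall m, D m -> exists m1 m2, m = (m1 + m2)%MM /\ S 'X_[m2]) ->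
  ideal_gen S = mon_ideal D.
Proof.
move=> upD SD DS; apply/seteqP; split=> f /=.
  by move=> [m [c [s [Ss ->]]]]; apply: mon_ideal_sum => // i; apply/SD.
move=> Df; pose t := in_tuple (msupp f).
have /choice[h hP] : forall i : 'I_(size (msupp f)), exists h : 'X_{1..n} * 'X_{1..n},
    tnth t i = (h.1 + h.2)%MM /\ S 'X_[h.2].
  move=> i; have /DS[m1 [m2 h]] : D (tnth t i).
    by apply: Df; rewrite -mcoeff_msupp (mem_tnth i t).
  by exists (m1, m2).
exists (size (msupp f)), (fun i => f@_(tnth t i) *: 'X_[(h i).1]), (fun i => 'X_[(h i).2]).
split=> [i|]; first by case: (hP i).
rewrite {1}[f]mpolyE (big_tnth _ _ (msupp f)); apply: eq_bigr => i _.
by rewrite -scalerAl -mpolyXD -(proj1 (hP i)).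
Qed.

Lemma mdeg_inD A m m' : mdeg_in A (m + m')%MM = (mdeg_in A m + mdeg_in A m')%N.
Proof. by rewrite /mdeg_in -big_split; apply: eq_bigr => j _; rewrite mnmDE. Qed.

Lemma mdeg_in1 A j : mdeg_in A U_(j)%MM = (j \in A).
Proof.
have zero i : i != j -> U_(j)%MM i = 0%N by rewrite mnm1E eq_sym => /negPf ->.
have [jA|jA] := boolP (j \in A).
  by rewrite /mdeg_in (bigD1 j) //= big1 => [|i /andP[_ /zero]//]; rewrite mnm1E eqxx.
by apply: big1 => i iA; apply: zero; apply: contraNneq jA => <-.
Qed.

Lemma mdeg_in_gt0 A m : (0 < mdeg_in A m)%N ->
  exists2 j, j \in A & m = (m - U_(j) + U_(j))%MM.
Proof.
rewrite lt0n sum_nat_eq0 negb_forall => /existsP[j].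
by rewrite negb_imply -lep1mP => /andP[jA /submK mj]; exists j.
Qed.

Lemma upward_closed_mdeg_in A p : upward_closed (fun m => p <= mdeg_in A m)%N.
Proof. by move=> m m' /= pm; rewrite mdeg_inD (leq_trans pm) ?leq_addr. Qed.

Lemma upward_closedI D E :
  upward_closed D -> upward_closed E -> upward_closed (predI D E).
Proof. by move=> upD upE m m' /andP[/upD Dm /upE Em]; apply/andP. Qed.

Lemma var_idealE A : var_ideal A = mon_ideal (fun m => 0 < mdeg_in A m)%N.
Proof.
apply: ideal_genE => [|_ [j jA <-]|m]; first exact: upward_closed_mdeg_in.
  by apply/mon_idealX; rewrite mdeg_in1 [j \in A]jA.
move/mdeg_in_gt0 => [j jA ->]; exists (m - U_(j))%MM, U_(j)%MM; split=> //.
by exists j.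
Qed.

Lemma ideal_mulE D E F : upward_closed F ->
    (forall m1 m2, D m1 -> E m2 -> F (m1 + m2)%MM) ->
    (forall m, F m -> exists m1 m2, [/\ m = (m1 + m2)%MM, D m1 & E m2]) ->
  ideal_mul (mon_ideal D) (mon_ideal E) = mon_ideal F.
Proof.
move=> upF DEF FDE; apply: ideal_genE => // [_ [f Df [g Eg <-]] m|m Fm].
  by move=> /mcoeffM_neq0[m1 [m2 [-> fm1 gm2]]]; apply: DEF; [apply: Df|apply: Eg].
have [m1 [m2 [-> Dm1 Em2]]] := FDE m Fm.
exists 0%MM, (m1 + m2)%MM; rewrite add0m; split=> //.
by exists 'X_[m1]; [apply/mon_idealX|exists 'X_[m2]; [apply/mon_idealX|rewrite mpolyXD]].
Qed.

Lemma ideal_addE D E :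
  ideal_add (mon_ideal D) (mon_ideal E) = mon_ideal (predU D E).
Proof.
apply/seteqP; split=> [_ [f Df [g Eg <-]]|f DEf].
  by apply: mon_idealD => m fm; apply/orP; [left; apply: Df|right; apply: Eg].
exists (mrestrict D f) => [m|]; rewrite ?mcoeff_mrestrict.
  by case: (D m); rewrite ?eqxx.
exists (mrestrict (predC D) f) => [m|].
  rewrite mcoeff_mrestrict /=; case: ifP => [nDm /DEf/orP[Dm|//]|]; last by rewrite eqxx.
  by rewrite Dm in nDm.
apply/mpolyP => m; rewrite mcoeffD !mcoeff_mrestrict /=.
by case: (D m); rewrite ?addr0 ?add0r.
Qed.

Lemma eq_mon_ideal D E : D =1 E -> mon_ideal D = mon_ideal E.
Proof. by move=> /funext ->. Qed.

Lemma mon_ideal_eq0 D : (forall m, ~~ D m) -> mon_ideal D = [set 0]%classic.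
Proof.
move=> nD; apply/seteqP; split=> f /=; last by move=> ->; apply: mon_ideal0.
move=> Df; apply/mpolyP => m; rewrite mcoeff0; apply/eqP.
by apply: contraNT (nD m) => /Df.
Qed.

Lemma mon_idealI D E :
  (mon_ideal D `&` mon_ideal E)%classic = mon_ideal (predI D E).
Proof.
apply/seteqP; split=> f => [[Df Ef] m fm|DEf]; first by rewrite /= Df ?Ef.
by split=> m /DEf/andP[].
Qed.

Lemma ideal_expE A p :
  ideal_exp (var_ideal A) p = mon_ideal (fun m => p <= mdeg_in A m)%N.
Proof.
elim: p => [|p IHp]; first by apply/seteqP; split.
rewrite /ideal_exp iterS -/(ideal_exp _ p) IHp var_idealE.
apply: ideal_mulE => [|m1 m2 m1A m2A|m pm]; first exact: upward_closed_mdeg_in.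
  by rewrite mdeg_inD -add1n leq_add.
have [j jA mj] := mdeg_in_gt0 (leq_ltn_trans (leq0n p) pm).
exists U_(j)%MM, (m - U_(j))%MM; rewrite mdeg_in1 jA addmC; split=> //.
by move: pm; rewrite {1}mj mdeg_inD mdeg_in1 jA addn1.
Qed.

(** For upward closed [D] this means that the ideal is generated by monomials in the variables
    outside [A]; multiplying it by m_A^p is then the same as intersecting it with m_A^p. *)
Definition independent_of A D :=
  forall m m' : 'X_{1..n}, (forall j, j \notin A -> m j = m' j) -> D m = D m'.

Lemma independent_of_mdeg_in A B p :
  [disjoint A & B] -> independent_of B (fun m => p <= mdeg_in A m)%N.
Proof.
move=> AB m m' mm'; congr (_ <= _)%N; apply: eq_bigr => j jA; apply: mm'.
by rewrite (disjointFr AB).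
Qed.

Lemma independent_ofI A D E :
  independent_of A D -> independent_of A E -> independent_of A (predI D E).
Proof. by move=> iD iE m m' mm'; rewrite /= (iD m m') ?(iE m m'). Qed.

Lemma independent_ofU A D m j :
  independent_of A D -> j \in A -> D (m + U_(j))%MM = D m.
Proof.
move=> iD jA; apply: iD => i iA; rewrite mnmDE mnm1E.
by have [ji|_] := eqVneq j i; [rewrite -ji jA in iA|rewrite addn0].
Qed.

Lemma ideal_mul_expE A D p : upward_closed D -> independent_of A D ->
  ideal_mul (mon_ideal D) (ideal_exp (var_ideal A) p) =
  mon_ideal (predI D (fun m => p <= mdeg_in A m)%N).
Proof.
move=> upD iD; rewrite ideal_expE; apply: ideal_mulE.
- exact/upward_closedI/upward_closed_mdeg_in.
- move=> m1 m2 Dm1 pm2; rewrite /= upD // mdeg_inD.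
  by rewrite (leq_trans pm2) ?leq_addl.
(* [m2] is the part of [m] in the variables of [A]; removing it does not affect [D]. *)
move=> m /andP[Dm pm]; pose m2 := [multinom if j \in A then m j else 0%N | j < n]%MM.
have m2m : (m2 <= m)%MM by apply/mnm_lepP => j; rewrite mnmE; case: ifP.
exists (m - m2)%MM, m2; split; first by rewrite submK.
  rewrite (iD _ m) // => j jA; rewrite mnmBE mnmE (negPf jA) subn0 //.
suff -> : mdeg_in A m2 = mdeg_in A m by [].
by apply: eq_bigr => j jA; rewrite mnmE jA.
Qed.

End MonomialIdeals.

(** * Graded matrices and their constant terms *)

Section GradedMatrices.
Context {k : fieldType} {n : nat}.
Local Notation R := {mpoly k[n]}.

(** The additive form covers both branches of [degree0_entry]: if [s < t], no exponent satisfies the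
    equation, which forces [f = 0]. *)
Lemma degree0_entryP s t (f : R) :
  reflect (forall m, f@_m != 0 -> (mdeg m + t)%N = s) (degree0_entry s t f).
Proof.
rewrite /degree0_entry; case: leqP => [ts|st].
  apply: (iffP (dhomogP _ _ _)) => h m; rewrite ?mcoeff_msupp => fm.
    by rewrite (h m) ?mcoeff_msupp //= subnK.
  by rewrite /= -(h m fm) addnK.
apply: (iffP eqP) => [-> m|h]; first by rewrite mcoeff0 eqxx.
apply/mpolyP => m; rewrite mcoeff0; apply/eqP/negPn/negP => /h ms.
by rewrite -ms ltnNge leq_addl in st.
Qed.

Definition graded_mx m p (s : 'I_m -> nat) (t : 'I_p -> nat) (M : 'M[R]_(m, p)) :=
  forall i j, degree0_entry (s i) (t j) (M i j).

Lemma graded_mx1 m (s : 'I_m -> nat) : graded_mx s s 1%:M.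
Proof.
move=> i j; apply/degree0_entryP => a; rewrite mxE.
have [<-|_] := eqVneq i j; rewrite ?mcoeff0 ?eqxx // mcoeff1.
by have [->|_] := eqVneq a 0%MM; rewrite ?mdeg0 // eqxx.
Qed.

Lemma graded_mx_mul m p q (s : 'I_m -> nat) (t : 'I_p -> nat) (u : 'I_q -> nat)
    (M : 'M[R]_(m, p)) (N : 'M_(p, q)) :
  graded_mx s t M -> graded_mx t u N -> graded_mx s u (M *m N).
Proof.
move=> gM gN i j; apply/degree0_entryP => a; rewrite mxE raddf_sum /= => MNa.
have /existsP[l Ml] : [exists l, (M i l * N l j)@_a != 0].
  apply: contraNT MNa; rewrite negb_exists => /forallP MN0.
  by apply/eqP/big1 => l _; apply/eqP; rewrite -[_ == _]negbK MN0.
have [a1 [a2 [-> /(degree0_entryP _ _ _ (gM i l)) <-]]] := mcoeffM_neq0 Ml.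
by move=> /(degree0_entryP _ _ _ (gN l j)) <-; rewrite mdegD addnA.
Qed.

(* The solution is truncated entrywise to the right degree. *)
Lemma graded_mx_solve m p q (s : 'I_m -> nat) (t : 'I_p -> nat) (u : 'I_q -> nat)
    (X : 'M[R]_(m, p)) (M : 'M_(p, q)) :
  graded_mx t u M -> graded_mx s u (X *m M) ->
  exists2 X', graded_mx s t X' & X' *m M = X *m M.
Proof.
move=> gM gXM.
exists (\matrix_(i, j) mrestrict (fun a => mdeg a + t j == s i)%N (X i j)).
  move=> i j; apply/degree0_entryP => a; rewrite mxE mcoeff_mrestrict.
  by case: ifP => [/eqP//|_]; rewrite eqxx.
apply/matrixP => i j; apply/mpolyP => a.
(* The product is already homogeneous, so truncating it changes nothing; it remains to see that
   truncation commutes with the product. *)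
have -> : (X *m M) i j = mrestrict (fun a => mdeg a + u j == s i)%N ((X *m M) i j).
  apply/mpolyP => b; rewrite mcoeff_mrestrict; case: eqP => // sb.
  by apply/eqP/negPn/negP => /(degree0_entryP _ _ _ (gXM i j)).
rewrite mcoeff_mrestrict !mxE !raddf_sum /=.
transitivity (\sum_l if (mdeg a + u j == s i)%N then (X i l * M l j)@_a else 0); last first.
  by case: ifP => // _; rewrite big1.
apply: eq_bigr => l _; rewrite mxE !mcoeffM.
transitivity (\sum_(b : 'X_{1..n < (mdeg a).+1, (mdeg a).+1} | a == (b.1 + b.2)%MM)
  if (mdeg a + u j == s i)%N then (X i l)@_b.1 * (M l j)@_b.2 else 0); last first.
  by case: ifP => // _; rewrite big1.
apply: eq_bigr => -[b1 b2] /=; move: (bmnm b1) (bmnm b2) => a1 a2 /eqP ->.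
rewrite mcoeff_mrestrict.
(* A nonzero coefficient of [M] at [a2] gives [mdeg a2 + u j = t l], so the two degree tests
   coincide. *)
have [->|Ma2] := eqVneq (M l j)@_a2 0; first by rewrite !mulr0 if_same.
rewrite mdegD -addnA (degree0_entryP _ _ _ (gM l j) _ Ma2).
by case: ifP; rewrite ?mul0r.
Qed.

Definition glue m1 m2 (s1 : 'I_m1 -> nat) (s2 : 'I_m2 -> nat) (i : 'I_(m1 + m2)) :=
  match split i with inl i1 => s1 i1 | inr i2 => s2 i2 end.

Lemma card_glue m1 m2 (s1 : 'I_m1 -> nat) (s2 : 'I_m2 -> nat) d :
  #|[set i | glue s1 s2 i == d]| =
  (#|[set i | s1 i == d]| + #|[set i | s2 i == d]|)%N.
Proof.
rewrite -!sum1dep_card big_split_ord /=.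
by congr (_ + _)%N; apply: eq_bigl => i; rewrite /glue (unsplitK (inl _), unsplitK (inr _)).
Qed.

Lemma graded_mx_col m1 m2 p (s1 : 'I_m1 -> nat) (s2 : 'I_m2 -> nat) (t : 'I_p -> nat)
    (M1 : 'M[R]_(m1, p)) (M2 : 'M_(m2, p)) :
  graded_mx s1 t M1 -> graded_mx s2 t M2 -> graded_mx (glue s1 s2) t (col_mx M1 M2).
Proof. by move=> g1 g2 i j; rewrite mxE /glue; case: split. Qed.

Lemma graded_mx_row m p1 p2 (s : 'I_m -> nat) (t1 : 'I_p1 -> nat) (t2 : 'I_p2 -> nat)
    (M1 : 'M[R]_(m, p1)) (M2 : 'M_(m, p2)) :
  graded_mx s t1 M1 -> graded_mx s t2 M2 -> graded_mx s (glue t1 t2) (row_mx M1 M2).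
Proof. by move=> g1 g2 i j; rewrite mxE /glue; case: split. Qed.

Lemma graded_mx0 m p (s : 'I_m -> nat) (t : 'I_p -> nat) : graded_mx s t (0 : 'M[R]_(m, p)).
Proof. by move=> i j; apply/degree0_entryP => a; rewrite mxE mcoeff0 eqxx. Qed.

Lemma graded_mxN m p (s : 'I_m -> nat) (t : 'I_p -> nat) (M : 'M[R]_(m, p)) :
  graded_mx s t M -> graded_mx s t (- M).
Proof.
move=> gM i j; apply/degree0_entryP => a; rewrite mxE mcoeffN oppr_eq0.
exact/degree0_entryP/gM.
Qed.

(** Reduction modulo (x_1, ..., x_n), a ring morphism onto [k], hence compatible with matrix
    products. *)
Definition const_term m p (M : 'M[R]_(m, p)) : 'M[k]_(m, p) :=
  map_mx (mcoeff 0%MM) M.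

Lemma maximal_idealE (f : R) : var_ideal [set: 'I_n] f <-> f@_0%MM = 0.
Proof.
rewrite var_idealE; split=> [|f0 m fm].
  move=> /(_ 0%MM) f0; apply/eqP/negPn/negP => /f0.
  by rewrite /mdeg_in big1 // => i _; rewrite mnm0E.
have -> : mdeg_in [set: 'I_n] m = mdeg m.
  by rewrite mdegE; apply: eq_bigl => i; rewrite inE.
by rewrite lt0n mdeg_eq0; apply: contraNneq fm => ->; apply/eqP.
Qed.

(* Constant terms of a graded matrix are block diagonal with respect to the shifts. *)
Lemma card_graded_le m p (s : 'I_m -> nat) (t : 'I_p -> nat)
    (M : 'M[R]_(m, p)) (N : 'M_(p, m)) d :
    graded_mx s t M -> graded_mx t s N ->
    const_term M *m const_term N = 1%:M ->
  (#|[set i | s i == d]| <= #|[set i | t i == d]|)%N.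
Proof.
move=> gM gN MN1; set S := [set i | s i == d]; set T := [set i | t i == d].
pose M' := mxsub (@enum_val _ S) (@enum_val _ T) (const_term M).
pose N' := mxsub (@enum_val _ T) (@enum_val _ S) (const_term N).
(* The blocks of shift [d] still multiply to 1, because a nonzero constant entry joins equal shifts;
   a one-sided inverse bounds the number of rows by the number of columns. *)
apply: (@mulmx1_min _ _ _ M' N').
apply/matrixP => i j; have := congr1 (fun Q : 'M[k]_m => Q (enum_val i) (enum_val j)) MN1.
rewrite !mxE (inj_eq enum_val_inj) => <-.
rewrite [RHS](bigID (mem T)) /= [X in _ + X]big1 ?addr0 => [|l lT]; last first.
  rewrite !mxE; suff -> : (M (enum_val i) l)@_0%MM = 0 by rewrite mul0r.
  apply/eqP; apply: contraNT lT => /(degree0_entryP _ _ _ (gM _ _)) tl.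
  by have := enum_valP i; rewrite !inE -tl mdeg0.
by rewrite [RHS]big_enum_val; apply: eq_bigr => l _; rewrite !mxE.
Qed.

End GradedMatrices.

(** The types vary with [i] and a successor exists only under the invariant [Q], so the sequence is
    built in the subtypes cut out by [Q] and then projected. *)
Lemma dependent_choice_nat (T : nat -> Type) (Q : forall i, T i -> Prop)
    (S : forall i, T i -> T i.+1 -> Prop) (x0 : T 0) : Q 0 x0 ->
    (forall i x, Q i x -> exists2 y, S i x y & Q i.+1 y) ->
  exists2 x : forall i, T i, x 0 = x0 & forall i, S i (x i) (x i.+1).
Proof.
move=> Qx0 step.
pose next i (x : {x | Q i x}) := let: exist2 y _ Qy := cid2 (step i (sval x) (svalP x)) in
  exist (Q i.+1) y Qy.
pose x := fix x i : {x | Q i x} := if i is i'.+1 then next i' (x i') else exist (Q 0) x0 Qx0.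
exists (fun i => sval (x i)) => //= i.
by rewrite /next; case: cid2.
Qed.

(** * Comparison of resolutions and uniqueness of graded Betti numbers *)

Section Resolutions.
Context {k : fieldType} {n : nat}.
Local Notation R := {mpoly k[n]}.
Implicit Types (F G : @graded_free_chain k n) (I J : set R).

(* The augmented complex: R sits in index 0, and F_i in index i.+1. *)
Definition arank F i := if i is i'.+1 then grank F i' else 1%N.

Definition ashift F i : 'I_(arank F i) -> nat :=
  if i is i'.+1 then @gshift _ _ F i' else fun=> 0%N.

Definition adiff F i : 'M[R]_(arank F i.+1, arank F i) :=
  if i is i'.+1 then gdiff F i' else gaug F.

Lemma graded_adiff F i :
  graded_chain F -> graded_mx (@ashift F i.+1) (@ashift F i) (adiff F i).
Proof.
by case=> gaug_g gdiff_g; case: i => [|i] p q //=; rewrite ?ord1; apply: gaug_g.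
Qed.

Lemma rowwise_solve m p q (Y : 'M[R]_(m, q)) (M : 'M_(p, q)) :
  (forall i, exists w, row i Y = w *m M) -> exists X, Y = X *m M.
Proof.
move=> /fin_all_exists[w wP]; exists (\matrix_i w i); apply/row_matrixP => i.
by rewrite row_mul rowK -wP.
Qed.

Lemma adiff_exact F I i m (Y : 'M[R]_(m, arank F i.+1)) : resolves F I ->
  Y *m adiff F i = 0 <-> exists X, Y = X *m adiff F i.+1.
Proof.
case=> _ ex0 ex.
have exact (v : 'rV_(arank F i.+1)) :
    v *m adiff F i = 0 <-> exists w, v = w *m adiff F i.+1.
  by case: i v {Y} => [|i] v /=; [apply: ex0|apply: ex].
split=> [Y0|[X ->]].
  by apply: rowwise_solve => j; apply/exact; rewrite -row_mul Y0 row0.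
apply/row_matrixP => j; rewrite -mulmxA row_mul row0 mulmxA.
by apply/exact; exists (row j X).
Qed.

Lemma adiff_comp F I i : resolves F I -> adiff F i.+1 *m adiff F i = 0.
Proof. by move=> FI; apply/(adiff_exact _ FI); exists 1%:M; rewrite mul1mx. Qed.

Lemma gaug_mem F I p : resolves F I -> I (gaug F p 0).
Proof.
case=> FI _ _; apply/FI; exists (delta_mx 0 p).
by rewrite -rowE; apply/rowP => j; rewrite !mxE !ord1 eqxx mulr1n.
Qed.

(** Comparison theorem: exactness of [G] lifts the identity of R step by step, and [graded_mx_solve]
    makes each lift graded. *)
Lemma chain_lift F G I J :
    graded_chain F -> graded_chain G -> resolves F I -> resolves G J ->
    (I `<=` J)%classic ->
  exists phi : forall i, 'M[R]_(arank F i, arank G i),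
    [/\ phi 0 = 1%:M, forall i, graded_mx (@ashift F i) (@ashift G i) (phi i)
      & forall i, phi i.+1 *m adiff G i = adiff F i *m phi i].
Proof.
move=> gF gG FI GJ IJ.
(* The invariant includes the existence of a next lift, with no condition on its degrees. *)
pose Q i (A : 'M[R]_(arank F i, arank G i)) :=
  graded_mx (@ashift F i) (@ashift G i) A /\ exists X, X *m adiff G i = adiff F i *m A.
pose S i (A : 'M[R]_(arank F i, arank G i)) (B : 'M[R]_(arank F i.+1, arank G i.+1)) :=
  graded_mx (@ashift F i.+1) (@ashift G i.+1) B /\ B *m adiff G i = adiff F i *m A.
have [|i A|phi phi0 phiS] := @dependent_choice_nat _ Q S 1%:M.
- split; first exact: (@graded_mx1 _ _ _ (@ashift F 0)).
  have [X ->] : exists X, adiff F 0 = X *m adiff G 0; last by exists X; rewrite mulmx1.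
  apply: rowwise_solve => p; have [GJ' _ _] := GJ.
  have /IJ/GJ'[w wE] := gaug_mem p FI; exists w; rewrite wE.
  by apply/rowP => j; rewrite !mxE !ord1 eqxx mulr1n.
- move=> [gA [X XE]].
  have [|B gB BE] :=
    @graded_mx_solve _ _ _ _ _ (@ashift F i.+1) _ _ X _ (@graded_adiff G i gG).
    by rewrite XE; apply/graded_mx_mul/gA/graded_adiff.
  exists B; first by split=> //; rewrite BE.
  split=> //; have [|Z ->] := (adiff_exact (adiff F i.+1 *m B) GJ).1; last by exists Z.
  by rewrite -mulmxA BE XE mulmxA (adiff_comp _ FI) mul0mx.
exists phi; split=> // i; last by case: (phiS i).
by case: i => [|i]; [rewrite phi0; apply: (@graded_mx1 _ _ _ (@ashift F 0))|case: (phiS i)].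
Qed.

(* A chain map over the identity of R is homotopic to the identity, and the
   homotopy terms vanish modulo the maximal ideal by minimality. *)
Lemma const_term_chain_endo F I (theta : forall i, 'M[R]_(arank F i, arank F i)) :
    resolves F I -> minimal_chain F -> theta 0 = 1%:M ->
    (forall i, theta i.+1 *m adiff F i = adiff F i *m theta i) ->
  forall i, const_term (theta i.+1) = 1%:M.
Proof.
move=> FI minF theta0 thetaC i.
(* [s] and [s'] are consecutive homotopy terms. The first one must vanish for [i = 0], since
   minimality does not constrain [gaug], which may have a unit entry. *)
have [s [s' [sE s0]]] : exists s s',
    theta i.+1 = 1%:M + adiff F i *m s + s' *m adiff F i.+1 /\ (i = 0%N -> s = 0).
  elim: i => [|i [s [s' [thE _]]]].
    have [|s' s'E] := (adiff_exact (theta 1%N - 1%:M) FI).1.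
      by rewrite mulmxBl thetaC theta0 mulmx1 mul1mx subrr.
    by exists 0, s'; rewrite mulmx0 addr0 -s'E addrC subrK.
  have [|s'' s''E] := (adiff_exact (theta i.+2 - 1%:M - adiff F i.+1 *m s') FI).1.
    rewrite !mulmxBl thetaC thE !mulmxDr mulmx1 mul1mx -!mulmxA.
    rewrite [adiff F i.+1 *m (adiff F i *m s)]mulmxA (adiff_comp _ FI) mul0mx.
    by rewrite addr0 [_ + _ *m _]addrC addrK subrr.
  exists s', s''; split=> //.
  by rewrite -s''E -[_ - _ - _]addrA -opprD [RHS]addrC subrK.
have const0 m p q (A : 'M[R]_(m, p)) (B : 'M_(p, q)) :
    const_term (A *m B) = const_term A *m const_term B by apply: map_mxM.
have constd j : const_term (gdiff F j) = 0.
  by apply/matrixP => p q; rewrite !mxE; apply/maximal_idealE/minF.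
rewrite sE /const_term !map_mxD map_mx1 -!/(const_term _) !const0 /= constd mulmx0.
case: i s s' {sE} s0 => [|i] s s' s0 /=.
  by rewrite s0 // /const_term map_mx0 mulmx0 !addr0.
by rewrite constd mul0mx !addr0.
Qed.

(** Lifts in both directions compose to a chain endomorphism over the identity of R, so their
    constant terms are one-sided inverses and [card_graded_le] applies. *)
Lemma gcount_le F G I i j : minimal_graded_free_resolution F I ->
  minimal_graded_free_resolution G I -> (gcount F i j <= gcount G i j)%N.
Proof.
move=> [gF FI minF] [gG GI _].
have [phi [phi0 gphi phiC]] := chain_lift gF gG FI GI (fun _ x => x).
have [psi [psi0 gpsi psiC]] := chain_lift gG gF GI FI (fun _ x => x).
apply: (card_graded_le j (gphi i.+1) (gpsi i.+1)).
rewrite -map_mxM; apply: (const_term_chain_endo (theta := fun i => phi i *m psi i) FI minF).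
  by rewrite phi0 psi0 mulmx1.
by move=> l; rewrite -mulmxA psiC mulmxA phiC mulmxA.
Qed.

Lemma bettiE F I i j :
  minimal_graded_free_resolution F I -> betti i j I = gcount F i j.
Proof.
move=> FI; apply: xget_unique; first by exists F.
by move=> _ [G [GI ->]]; apply/eqP; rewrite eqn_leq !(@gcount_le _ _ I).
Qed.

End Resolutions.

(** * The mapping cone and its minimality *)

Section MappingCone.
Context {k : fieldType} {n : nat}.
Local Notation R := {mpoly k[n]}.
Implicit Types (F : @graded_free_chain k n) (I : set R).

Lemma minimal_chainE F : minimal_chain F <-> forall i, const_term (gdiff F i) = 0.
Proof.
split=> minF i; first by apply/matrixP => p q; rewrite !mxE; apply/maximal_idealE/minF.
move=> p q; apply/maximal_idealE.
by have := congr1 (fun M : 'M[k]__ => M p q) (minF i); rewrite !mxE.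
Qed.

Definition shifts_in (lo hi : nat) F :=
  forall i (p : 'I_(grank F i)), (i + lo <= gshift p <= i + hi)%N.

Lemma const_term_graded m p (s : 'I_m -> nat) (t : 'I_p -> nat) (M : 'M[R]_(m, p)) :
  graded_mx s t M -> (forall i j, t j < s i)%N -> const_term M = 0.
Proof.
move=> gM st; apply/matrixP => i j; rewrite !mxE; apply/eqP/negPn/negP.
move/(degree0_entryP _ _ _ (gM i j)); rewrite mdeg0 => tj.
by have := st i j; rewrite -tj ltnn.
Qed.

Variables (FP FQ FN : @graded_free_chain k n) (P Q : set R).
Hypotheses (resP : minimal_graded_free_resolution FP P)
  (resQ : minimal_graded_free_resolution FQ Q)
  (resN : minimal_graded_free_resolution FN (P `&` Q)%classic).
Variables (phi : forall i, 'M[R]_(arank FN i, arank FP i))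
  (psi : forall i, 'M[R]_(arank FN i, arank FQ i)).
Hypotheses (phi0 : phi 0 = 1%:M) (psi0 : psi 0 = 1%:M).
Hypotheses (gphi : forall i, graded_mx (@ashift _ _ FN i) (@ashift _ _ FP i) (phi i))
  (gpsi : forall i, graded_mx (@ashift _ _ FN i) (@ashift _ _ FQ i) (psi i)).
Hypotheses (phiC : forall i, phi i.+1 *m adiff FP i = adiff FN i *m phi i)
  (psiC : forall i, psi i.+1 *m adiff FQ i = adiff FN i *m psi i).

(* FN is shifted by one homological degree in the cone: FN_i sits next to
   FP_{i+1} and FQ_{i+1}. *)
Let nrank i := if i is i'.+1 then grank FN i' else 0%N.
Let nshift i : 'I_(nrank i) -> nat := if i is i'.+1 then @gshift _ _ FN i' else fun=> 0%N.
Let ndiff i : 'M[R]_(nrank i.+1, nrank i) := if i is i'.+1 then gdiff FN i' else 0.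

(** The augmentation adds the two images, so its kernel contains P [&] Q embedded by [phi] and
    [- psi]; the sign of [- ndiff] makes consecutive maps compose to zero. *)
Definition cone : @graded_free_chain k n := {|
  grank i := (grank FP i + grank FQ i + nrank i)%N;
  gshift i := glue (glue (@gshift _ _ FP i) (@gshift _ _ FQ i)) (@nshift i);
  gdiff i := col_mx (row_mx (block_mx (gdiff FP i) 0 0 (gdiff FQ i)) 0)
                    (row_mx (row_mx (phi i.+1) (- psi i.+1)) (- ndiff i));
  gaug := col_mx (col_mx (gaug FP) (gaug FQ)) (0 : 'cV_(nrank 0)) |}.

Lemma graded_cone : graded_chain cone.
Proof.
have [[[gP _ _] [gQ _ _]] [gN _ _]] := (resP, resQ, resN).
split=> [p|i].
  have g : graded_mx (@ashift _ _ cone 1) (@ashift _ _ cone 0) (gaug cone).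
    apply/graded_mx_col/graded_mx0/graded_mx_col; first exact: (@graded_adiff _ _ FP 0).
    exact: (@graded_adiff _ _ FQ 0).
  exact: g.
apply/graded_mx_col; apply/graded_mx_row.
- apply/graded_mx_col; apply/graded_mx_row; try exact: graded_mx0.
    exact: (@graded_adiff _ _ FP i.+1).
  exact: (@graded_adiff _ _ FQ i.+1).
- exact: graded_mx0.
- by apply/graded_mx_row; [exact: (@gphi i.+1)|apply: graded_mxN; exact: (@gpsi i.+1)].
apply: graded_mxN; case: i => [|i]; first exact: graded_mx0.
exact: (@graded_adiff _ _ FN i.+1).
Qed.

Lemma mul_cone_diff i (x : 'rV[R]_(grank FP i.+1)) (y : 'rV_(grank FQ i.+1))
    (z : 'rV_(grank FN i)) :
  row_mx (row_mx x y) z *m gdiff cone i =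
  row_mx (row_mx (x *m gdiff FP i + z *m phi i.+1) (y *m gdiff FQ i - z *m psi i.+1))
         (- (z *m ndiff i)).
Proof.
rewrite /= mul_row_col !mul_mx_row mul_row_block !mulmx0 addr0 add0r.
by rewrite !add_row_mx add0r !mulmxN.
Qed.

Lemma mul_cone_aug (x : 'rV[R]_(grank FP 0)) (y : 'rV_(grank FQ 0)) (z : 'rV_0) :
  row_mx (row_mx x y) z *m gaug cone = x *m gaug FP + y *m gaug FQ.
Proof. by rewrite /= !mul_row_col mulmx0 addr0. Qed.

(** Diagram chase: the component over P [&] Q is found first, from [FN]; it corrects the other two
    components to cycles, which are boundaries in [FP] and [FQ]. *)
Lemma resolves_cone : resolves cone (ideal_add P Q).
Proof.
have [[[_ rP _] [_ rQ _]] [_ rN _]] := (resP, resQ, resN).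
have [[[memP exP _] [memQ exQ _]] [memN _ _]] := (rP, rQ, rN).
split.
- move=> f; split=> [[g /memP[x gE] [h /memQ[y hE] <-]]|[v]].
    by exists (row_mx (row_mx x y) 0); rewrite mul_cone_aug gE hE raddfD.
  rewrite -[v]hsubmxK -[lsubmx v]hsubmxK mul_cone_aug.
  set x := lsubmx _; set y := rsubmx _ => E.
  exists ((x *m gaug FP) 0 0); first by apply/memP; exists x; apply: mx11_scalar.
  exists ((y *m gaug FQ) 0 0); first by apply/memQ; exists y; apply: mx11_scalar.
  by have := congr1 (fun M : 'M[R]__ => M 0 0) E; rewrite !mxE eqxx mulr1n.
- move=> v; rewrite -[v]hsubmxK -[lsubmx v]hsubmxK mul_cone_aug.
  move: (lsubmx (lsubmx v)) (rsubmx (lsubmx v)) (rsubmx v) => x y z0.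
  split=> [E|[w]].
    (* The two images cancel, so [f] lies both in [P] and in [Q]. *)
    have xE := mx11_scalar (x *m gaug FP); set f := (x *m _) 0 0 in xE.
    have yE : - (y *m gaug FQ) = f%:M by apply/eqP; rewrite -xE eq_sym -addr_eq0 E.
    have /memN[z zE] : (P `&` Q)%classic f.
      by split; [apply/memP; exists x|apply/memQ; exists (- y); rewrite mulNmx].
    have [|x' x'E] := (exP (x - z *m phi 1%N)).1.
      by rewrite mulmxBl -mulmxA (phiC 0) phi0 mulmx1 zE xE subrr.
    have [|y' y'E] := (exQ (y + z *m psi 1%N)).1.
      by rewrite mulmxDl -mulmxA (psiC 0) psi0 mulmx1 zE -yE subrr.
    exists (row_mx (row_mx x' y') z); rewrite mul_cone_diff -x'E -y'E subrK addrK.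
    by congr (row_mx _ _); rewrite !thinmx0.
  rewrite -[w]hsubmxK -[lsubmx w]hsubmxK mul_cone_diff.
  move: (lsubmx (lsubmx w)) (rsubmx (lsubmx w)) (rsubmx w) => x' y' z.
  move/eq_row_mx => [/eq_row_mx[-> ->] _].
  rewrite mulmxDl mulmxBl -!mulmxA (phiC 0) (psiC 0) phi0 psi0 !mulmx1.
  by rewrite (adiff_comp 0 rP) (adiff_comp 0 rQ) !mulmx0 add0r add0r subrr.
move=> i v; rewrite -[v]hsubmxK -[lsubmx v]hsubmxK mul_cone_diff.
move: (lsubmx (lsubmx v)) (rsubmx (lsubmx v)) (rsubmx v) => x y z.
split=> [/eqP|[w]].
  rewrite !row_mx_eq0 oppr_eq0 -andbA => /and3P[/eqP xE /eqP yE /eqP zE].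
  have [|z' z'E] := (adiff_exact (i := i) z rN).1.
    (* For [i = 0] the equation [zE] is vacuous; [z] is a cycle because [gaug FP] kills the boundary
       in [xE]. *)
    case: i x y z xE yE zE {v} => [|i] x y z xE yE zE //=.
    rewrite -[gaug FN]mulmx1 -phi0 -(phiC 0) mulmxA -[z *m _](addKr (x *m gdiff FP 0)) xE.
    by rewrite addr0 mulNmx -mulmxA (adiff_comp 0 rP) mulmx0 oppr0.
  have [|x' x'E] := (adiff_exact (i := i.+1) (x + z' *m phi i.+2) rP).1.
    by rewrite mulmxDl -mulmxA phiC mulmxA -z'E.
  have [|y' y'E] := (adiff_exact (i := i.+1) (y - z' *m psi i.+2) rQ).1.
    by rewrite mulmxBl -mulmxA psiC mulmxA -z'E.
  (* The sign compensates the block [- ndiff]. *)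
  exists (row_mx (row_mx x' y') (- z')); rewrite mul_cone_diff.
  by rewrite -x'E -y'E !mulNmx !opprK addrK subrK -z'E.
rewrite -[w]hsubmxK -[lsubmx w]hsubmxK mul_cone_diff.
move: (lsubmx (lsubmx w)) (rsubmx (lsubmx w)) (rsubmx w) => x' y' z'.
move/eq_row_mx => [/eq_row_mx[-> ->] ->].
have zz : z' *m ndiff i.+1 *m ndiff i = 0.
  rewrite -mulmxA; case: i z' {v x y z w x' y'} => [|i] z'; first exact: thinmx0.
  by rewrite (adiff_comp i.+1 rN) mulmx0.
rewrite mulmxDl mulmxBl !mulNmx opprK zz.
rewrite -!mulmxA (phiC i.+1) (psiC i.+1) (adiff_comp i.+1 rP) (adiff_comp i.+1 rQ).
by rewrite !mulmx0 !add0r subrr addNr !oppr0 !row_mx0.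
Qed.

Lemma gcount_cone i j : gcount cone i j =
  (gcount FP i j + gcount FQ i j + (if i is i'.+1 then gcount FN i' j else 0))%N.
Proof.
rewrite /gcount card_glue card_glue; congr (_ + _)%N; case: i => [|i] //.
by apply: eq_card0 => -[].
Qed.

Variables (lo hi : nat).
Hypotheses (lohi : (lo <= hi)%N) (rgP : shifts_in lo hi FP) (rgQ : shifts_in lo hi FQ)
  (rgN : shifts_in hi.+1 hi.+1 FN).

(** The generators of FN_i land in homological degree i + 1 with shift (i + 1) + hi, the top of the
    window. *)
Lemma shifts_in_cone : shifts_in lo hi cone.
Proof.
move=> i p; rewrite /= /glue; case: split => [q|]; first by case: split.
by case: i {p} => [|i] [] // p lt_p; have := rgN (Ordinal lt_p); rewrite /nshift; lia.
Qed.

(** Only the blocks [phi] and [psi] are new, and FN_i has shift i + hi + 1, above every shift of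
    FP_i and FQ_i. *)
Lemma minimal_cone : minimal_chain cone.
Proof.
have [[_ _ /minimal_chainE minP] [_ _ /minimal_chainE minQ]] := (resP, resQ).
have [_ _ /minimal_chainE minN] := resN.
apply/minimal_chainE => i.
rewrite /const_term map_col_mx !map_row_mx map_block_mx !map_mx0 !map_mxN.
rewrite -!/(const_term _) minP minQ.
have -> : const_term (phi i.+1) = 0.
  by apply: const_term_graded (@gphi i.+1) _ => p q /=; have := rgN p; have := rgP q; lia.
have -> : const_term (psi i.+1) = 0.
  by apply: const_term_graded (@gpsi i.+1) _ => p q /=; have := rgN p; have := rgQ q; lia.
have -> : const_term (ndiff i) = 0 by case: i => [|i] //=; rewrite /const_term map_mx0.
by rewrite !oppr0 /block_mx !(row_mx0, col_mx0).
Qed.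

End MappingCone.

(** * Ideals with a resolution in a given window of degrees *)

Section Resolvable.
Context {k : fieldType} {n : nat}.
Local Notation R := {mpoly k[n]}.
Implicit Types (P Q : set R) (D E : pred 'X_{1..n}) (A : {set 'I_n}).

Definition resolvable (lo hi : nat) P := exists2 F : graded_free_chain,
  minimal_graded_free_resolution F P & shifts_in lo hi F.

Lemma resolvable_widen lo lo' hi hi' P : (lo' <= lo)%N -> (hi <= hi')%N ->
  resolvable lo hi P -> resolvable lo' hi' P.
Proof.
by move=> lolo hihi [F FP rgF]; exists F => // i p; have := rgF i p; lia.
Qed.

Lemma betti_eq0 lo hi P i j : resolvable lo hi P ->
  ~~ (i + lo <= j <= i + hi)%N -> betti i j P = 0%N.
Proof.
move=> [F FP rgF] ij; rewrite (bettiE i j FP); apply: eq_card0 => p.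
by rewrite inE; apply: contraNF ij => /eqP <-.
Qed.

Lemma resolvable_add lo hi P Q : (lo <= hi)%N -> resolvable lo hi P ->
    resolvable lo hi Q -> resolvable hi.+1 hi.+1 (P `&` Q)%classic ->
  resolvable lo hi (ideal_add P Q) /\
  forall i j, betti i j (ideal_add P Q) = (betti i j P + betti i j Q +
    (if i is i'.+1 then betti i' j (P `&` Q)%classic else 0))%N.
Proof.
move=> lohi [FP resP rgP] [FQ resQ rgQ] [FN resN rgN].
have [[[gP rP _] [gQ rQ _]] [gN rN _]] := (resP, resQ, resN).
have [phi [phi0 gphi phiC]] := chain_lift gN gP rN rP (@subIsetl _ _ _).
have [psi [psi0 gpsi psiC]] := chain_lift gN gQ rN rQ (@subIsetr _ _ _).
have resC : minimal_graded_free_resolution (cone phi psi) (ideal_add P Q).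
  split; first exact: (graded_cone resP resQ resN).
    exact: (resolves_cone resP resQ resN).
  exact: (minimal_cone resP resQ resN gphi gpsi lohi rgP rgQ rgN).
split=> [|i j]; first by exists (cone phi psi) => //; apply: shifts_in_cone.
rewrite (bettiE i j resC) (bettiE i j resP) (bettiE i j resQ) gcount_cone.
by case: i => [|i] //; rewrite (bettiE i j resN).
Qed.

Lemma resolvable_setT : resolvable 0 0 [set: R]%classic.
Proof.
pose F : @graded_free_chain k n := {|
  grank i := (i == 0)%N : nat; gshift i p := 0%N; gdiff i := 0; gaug := 1%:M |}.
exists F; last by move=> [|i] [].
split; [split=> [p|i [] //]|split|by move=> i []].
- rewrite !ord1 mxE eqxx; apply/degree0_entryP => m; rewrite mcoeff1.
  by have [->|_] := eqVneq m 0%MM; rewrite ?mdeg0 ?eqxx.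
- by move=> f; split=> // _; exists f%:M; rewrite /= mulmx1.
- move=> v; rewrite /= mulmx1; split=> [->|[w ->]]; last by rewrite mulmx0.
  by exists 0; rewrite mul0mx.
by move=> i v; split=> _; [exists 0; rewrite mul0mx; apply: thinmx0|apply: mulmx0].
Qed.

(** Needed for positive powers of m_A with [A] empty; the empty resolution fits every window. *)
Lemma resolvable_zero lo hi : resolvable lo hi [set (0 : R)]%classic.
Proof.
pose F : @graded_free_chain k n := {|
  grank i := 0%N; gshift i p := 0%N; gdiff i := 0; gaug := 0 |}.
exists F; last by move=> i [].
split; [split=> [[]|i []] //|split|by move=> i []].
- move=> f; split=> [->|[v]]; first by exists 0; rewrite mul0mx raddf0.
  by rewrite mulmx0 => /matrixP/(_ 0 0); rewrite !mxE eqxx mulr1n => <-.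
- by move=> v; split=> _; [exists 0; rewrite mul0mx; apply: thinmx0|apply: mulmx0].
by move=> i v; split=> _; [exists 0; rewrite mul0mx; apply: thinmx0|apply: mulmx0].
Qed.

(** Multiplication by a variable is injective, so scaling the augmentation keeps its kernel, and
    every shift grows by one. *)
Lemma resolvable_mulX lo hi P (x : 'I_n) : resolvable lo hi P ->
  resolvable lo.+1 hi.+1 [set 'X_x * f | f in P]%classic.
Proof.
move=> [F [[gaugF gF] [memF ex0 ex] minF] rgF].
pose F' : @graded_free_chain k n := {|
  grank := grank F; gshift i p := (gshift p).+1; gdiff := gdiff F;
  gaug := 'X_x *: gaug F |}.
have X0 : 'X_x != 0 :> R.
  by apply/eqP => /mpolyP/(_ U_(x)%MM); rewrite mcoeffX eqxx mcoeff0 => /eqP; rewrite oner_eq0.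
exists F'; last by move=> i p; have := rgF i p; rewrite /=; lia.
split=> //; first split=> [p|i p q].
- apply/degree0_entryP => m; rewrite mxE => /mcoeffM_neq0[m1 [m2 [-> + +]]].
  rewrite mcoeffX; have [<- _|_] := eqVneq U_(x)%MM m1; last by rewrite eqxx.
  by move/(degree0_entryP _ _ _ (gaugF p)) => m2F; rewrite mdegD mdeg1 -addnA m2F.
- by apply/degree0_entryP => m /(degree0_entryP _ _ _ (gF i p q)) pq; rewrite addnS pq.
split=> //.
- move=> f; split=> [[g /memF[v vE] <-]|[v]].
    by exists v; rewrite /= -scalemxAr vE scale_scalar_mx.
  rewrite /= -scalemxAr => vE; exists ((v *m gaug F) 0 0).
    by apply/memF; exists v; apply: mx11_scalar.
  by have /matrixP/(_ 0 0) := vE; rewrite !mxE eqxx mulr1n.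
move=> v; rewrite -ex0 /= -scalemxAr; split=> [/eqP|->]; last by rewrite scaler0.
by rewrite scalemx_eq0 (negPf X0) => /eqP.
Qed.

Lemma mulX_mon_ideal D (x : 'I_n) :
  [set 'X_x * f | f in mon_ideal D]%classic =
  @mon_ideal k n (fun m => (m x != 0%N) && D (m - U_(x))%MM).
Proof.
apply/seteqP; split=> [_ [f Df <-] m|f Df].
  move=> /mcoeffM_neq0[m1 [m2 [-> + /Df Dm2]]].
  rewrite mcoeffX; have [<- _|_] := eqVneq U_(x)%MM m1; last by rewrite eqxx.
  by rewrite mnmDE mnm1E eqxx add1n addmC addmK.
(* [g] is the quotient of [f] by the variable; every exponent of [f] is divisible by it, so the
   truncated subtraction is exact. *)
pose g : R := \sum_(m <- msupp f) f@_m *: 'X_[m - U_(x)].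
have gE : 'X_x * g = f.
  rewrite [RHS]mpolyE mulr_sumr; apply: eq_big_seq => m; rewrite mcoeff_msupp.
  move=> /Df/andP[mx _]; rewrite -scalerAr -mpolyXD addmC submK //.
  by rewrite lep1mP.
exists g => // m gm.
have /Df : f@_(m + U_(x)) != 0 by rewrite -gE mulrC addmC mcoeffMX.
by rewrite addmK => /andP[].
Qed.

(* With A = x :: A', the ideal m_A^p splits as m_A'^p + x m_A^(p-1), and the two
   summands meet in x m_A'^p. *)
Lemma resolvable_mdeg_in A D d p : independent_of A D ->
    resolvable d d (@mon_ideal k n D) ->
  resolvable (p + d) (p + d)
    (@mon_ideal k n (predI D (fun m => p <= mdeg_in A m)%N)).
Proof.
(* The outer induction on the size of [A], for all [p], treats m_A'^(p+1); the inner one on [p]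
   treats the factor m_A^p of the second summand. *)
move=> + resD; have [c] := ubnP #|A|; elim: c => // c IHc in A p *.
rewrite ltnS => Ac iD; elim: p => [|p IHp].
  by rewrite (@eq_mon_ideal _ _ _ D) // => m; rewrite /= andbT.
have [->|[x xA]] := set_0Vmem A.
  rewrite mon_ideal_eq0; first exact: resolvable_zero.
  by move=> m; rewrite /= /mdeg_in big_set0 andbF.
set A' := A :\ x.
have mdegA m : mdeg_in A m = (m x + mdeg_in A' m)%N by rewrite /mdeg_in (big_setD1 x).
have xA' : x \notin A' by rewrite !inE eqxx.
have resP : resolvable (p.+1 + d) (p.+1 + d)
    (@mon_ideal k n (predI D (fun m => p.+1 <= mdeg_in A' m)%N)).
  apply: IHc; first by move: Ac; rewrite (cardsD1 x) xA.
  by move=> m m' mm'; apply: iD => j jA; apply: mm'; rewrite !inE negb_and jA orbT.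
have resQ := resolvable_mulX x IHp; have resN := resolvable_mulX x resP.
rewrite !mulX_mon_ideal in resQ resN.
have DU m : D (m + U_(x))%MM = D m by apply: independent_ofU iD xA.
(* Writing the multiples of [x] as [m' + U_(x)] removes the truncated subtractions. *)
have split_x (m : 'X_{1..n}) : m x = 0%N \/ exists m', m = (m' + U_(x))%MM.
  have [?|mx] := eqVneq (m x) 0%N; first by left.
  by right; exists (m - U_(x))%MM; rewrite submK ?lep1mP.
have Ux m' : (m' + U_(x))%MM x != 0%N by rewrite mnmDE mnm1E eqxx addn1.
have [|+ _] := resolvable_add (leqnn _) resP resQ.
  move: resN; congr (resolvable _ _ _); rewrite mon_idealI; apply: eq_mon_ideal => m.
  have [mx|[m' ->]] := split_x m; rewrite /=; first by rewrite mx !andbF.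
  rewrite Ux DU addmK !mdeg_inD !mdeg_in1 (negPf xA') mdegA /=.
  by case: (D m') => //=; lia.
congr (resolvable _ _ _); rewrite ideal_addE; apply: eq_mon_ideal => m /=.
have [mx|[m' ->]] := split_x m; first by rewrite mx orbF mdegA mx.
rewrite Ux DU addmK !mdeg_inD !mdeg_in1 xA (negPf xA') mdegA /=.
by case: (D m') => //=; lia.
Qed.

Lemma big_ideal_addE (T : Type) (r : seq T) (D : T -> pred 'X_{1..n}) :
  \big[ideal_add/[set (0 : R)]%classic]_(t <- r) mon_ideal (D t) =
  mon_ideal (fun m => has (D^~ m) r).
Proof.
elim: r => [|t r IHr]; first by rewrite big_nil mon_ideal_eq0.
by rewrite big_cons IHr ideal_addE.
Qed.

End Resolvable.

(** * The ideals U, V and I built from their summands *)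

Section Decomposition.
Context {k : fieldType} {n : nat}.
Variables (a b : nat) (J K : {set 'I_n}).
Let dA := mdeg_in (J :\: K).
Let dB := mdeg_in (K :\: J).
Let dC := mdeg_in (J :&: K).
Local Notation mon D := (@mon_ideal k n D).

Definition box q p r m := [&& q <= dB m, p <= dA m & r <= dC m]%N.

(* The sums of the first T + 1 summands of U and of the first T summands of V. *)
Definition Upart T m := (a <= dA m + dC m)%N && (a <= dC m + T)%N.
Definition Vpart T m :=
  [&& 0 < dB m, a - b < dA m, b <= dC m + dB m, a <= dA m + dC m & b <= dC m + T]%N.

Lemma disjointAB : [disjoint K :\: J & J :\: K].
Proof. by apply/pred0P => j /=; rewrite !inE; case: (j \in J); rewrite ?andbF. Qed.

Lemma disjointAC : [disjoint J :\: K & J :&: K].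
Proof. by apply/pred0P => j /=; rewrite !inE; case: (j \in K); rewrite ?andbF. Qed.

Lemma disjointBC : [disjoint K :\: J & J :&: K].
Proof. by apply/pred0P => j /=; rewrite !inE; case: (j \in J); rewrite ?andbF. Qed.

Lemma box_ideal q p r :
  ideal_mul (ideal_mul (ideal_exp (var_ideal (K :\: J)) q)
                       (ideal_exp (var_ideal (J :\: K)) p))
            (ideal_exp (var_ideal (J :&: K)) r) = mon (box q p r).
Proof.
rewrite {1}ideal_expE ideal_mul_expE.
- rewrite ideal_mul_expE; first by apply: eq_mon_ideal => m /=; rewrite -andbA.
    by apply/upward_closedI; apply: upward_closed_mdeg_in.
  apply: independent_ofI; apply: independent_of_mdeg_in; first exact: disjointBC.
  exact: disjointAC.
- exact: upward_closed_mdeg_in.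
exact/independent_of_mdeg_in/disjointAB.
Qed.

(** Start from R and multiply in the powers of m_B, m_A and m_C in turn; disjointness keeps each
    product independent of the next block of variables. *)
Lemma resolvable_box q p r d : d = (q + p + r)%N -> resolvable d d (mon (box q p r)).
Proof.
move=> ->; have := @resolvable_setT k n.
have -> : [set: {mpoly k[n]}]%classic = mon predT by apply/seteqP; split.
move/(@resolvable_mdeg_in _ _ (K :\: J) _ _ q) => /(_ (fun _ _ _ => erefl)).
move/(@resolvable_mdeg_in _ _ (J :\: K) _ _ p) => /(_ _)/wrap[].
  by apply: independent_ofI => //; apply: independent_of_mdeg_in; exact: disjointAB.
move/(@resolvable_mdeg_in _ _ (J :&: K) _ _ r) => /(_ _)/wrap[].
  by do 2?apply: independent_ofI => //; apply: independent_of_mdeg_in;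
    [exact: disjointBC|exact: disjointAC].
rewrite addn0 (addnC p) (addnC r); congr (resolvable _ _ _).
by apply: eq_mon_ideal => m /=; rewrite -andbA.
Qed.

(** The summand m_A^(T+1) m_C^(a-T-1) meets the earlier ones in m_A^(T+1) m_C^(a-T), exactly one
    degree higher, so the sum stays linear. *)
Lemma resolvable_Upart T : (T <= a)%N -> resolvable a a (mon (Upart T)).
Proof.
elim: T => [_|T IHT Ta].
  have := @resolvable_box 0 0 a a erefl; congr (resolvable _ _ _).
  by apply: eq_mon_ideal => m; rewrite /box /Upart; lia.
have resU : resolvable a a (mon (box 0 T.+1 (a - T.+1))) by apply: resolvable_box; lia.
have resN : resolvable a.+1 a.+1 (mon (box 0 T.+1 (a - T))) by apply: resolvable_box; lia.
have [|+ _] := resolvable_add (leqnn _) (IHT (ltnW Ta)) resU.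
  move: resN; congr (resolvable _ _ _); rewrite mon_idealI; apply: eq_mon_ideal => m /=.
  by rewrite /box /Upart; lia.
congr (resolvable _ _ _); rewrite ideal_addE; apply: eq_mon_ideal => m /=.
by rewrite /box /Upart; lia.
Qed.

Hypotheses (hb : (1 <= b)%N) (hab : (b <= a)%N).

Lemma Vpart1 : Vpart 1 =1 box 1 (a - b + 1) (b - 1).
Proof. by move=> m; rewrite /box /Vpart; lia. Qed.

(** One step, adding V_(T+1), which is generated in degree a + T + 1. The last hypothesis says that
    it meets the ideal of [D] in m_C V_(T+1), one degree higher. *)
Lemma resolvable_addV D lo T : (lo <= a + T.+1)%N -> (T < b)%N ->
    resolvable lo (a + T.+1) (mon D) ->
    predI D (box T.+1 (a - b + T.+1) (b - T.+1)) =1 box T.+1 (a - b + T.+1) (b - T) ->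
  resolvable lo (a + T.+1) (mon (predU D (box T.+1 (a - b + T.+1) (b - T.+1)))) /\
  forall i j, betti i j (mon (predU D (box T.+1 (a - b + T.+1) (b - T.+1)))) =
    (betti i j (mon D) + betti i j (mon (box T.+1 (a - b + T.+1) (b - T.+1))) +
     (if i is i'.+1 then betti i' j (mon (box T.+1 (a - b + T.+1) (b - T))) else 0))%N.
Proof.
move=> loT Tb resD DE; rewrite -ideal_addE -(eq_mon_ideal DE) -mon_idealI.
apply: resolvable_add => //.
  by apply: resolvable_widen loT (leqnn _) _; apply: resolvable_box; lia.
by rewrite mon_idealI (eq_mon_ideal DE); apply: resolvable_box; lia.
Qed.

(** From the second summand on, V and I gain the same Betti numbers at each step. They differ only
    at the start: V begins with V_1, whereas I adds V_1 to U and so also gains the term from m_C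
    V_1. *)
Lemma betti_UV T : (T < b)%N ->
  [/\ resolvable a.+1 (a + T.+1) (mon (Vpart T.+1)),
      resolvable a (a + T.+1) (mon (predU (Upart (a - b)) (Vpart T.+1)))
    & forall i j, betti i j (mon (predU (Upart (a - b)) (Vpart T.+1))) =
        (betti i j (mon (Upart (a - b))) + betti i j (mon (Vpart T.+1)) +
         (if i is i'.+1 then betti i' j (mon (box 1 (a - b + 1) b)) else 0))%N].
Proof.
elim: T => [_|T IHT Tb].
  have resU : resolvable a (a + 1) (mon (Upart (a - b))).
    by apply: resolvable_widen (resolvable_Upart _) => //; lia.
  have [||resI bettiI] := @resolvable_addV (Upart (a - b)) a 0 _ hb resU.
  - by lia.
  - by move=> m; rewrite /box /Upart /=; lia.
  have UV : predU (Upart (a - b)) (Vpart 1) =1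
      predU (Upart (a - b)) (box 1 (a - b + 1) (b - 1)).
    by move=> m; rewrite /= Vpart1.
  split; first by rewrite (eq_mon_ideal Vpart1) addn1; apply: resolvable_box; lia.
    by rewrite (eq_mon_ideal UV).
  by move=> i j; rewrite (eq_mon_ideal UV) bettiI (eq_mon_ideal Vpart1) subn0.
have [resV resI bettiI] := IHT (ltnW Tb).
have [||| resV' bettiV] := @resolvable_addV (Vpart T.+1) a.+1 T.+1 _ Tb.
- by lia.
- by apply: resolvable_widen resV; lia.
- by move=> m; rewrite /box /Vpart /=; lia.
have [||| resI' bettiI'] := @resolvable_addV (predU (Upart (a - b)) (Vpart T.+1)) a T.+1 _ Tb.
- by lia.
- by apply: resolvable_widen resI; lia.
- by move=> m; rewrite /box /Vpart /Upart /=; lia.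
have VE : predU (Vpart T.+1) (box T.+2 (a - b + T.+2) (b - T.+2)) =1 Vpart T.+2.
  by move=> m; rewrite /box /Vpart /=; lia.
have IE : predU (predU (Upart (a - b)) (Vpart T.+1))
    (box T.+2 (a - b + T.+2) (b - T.+2)) =1 predU (Upart (a - b)) (Vpart T.+2).
  by move=> m; rewrite /= -VE /= orbA.
rewrite (eq_mon_ideal VE) in resV' bettiV; rewrite (eq_mon_ideal IE) in resI' bettiI'.
split=> // i j; rewrite bettiI' bettiI bettiV; lia.
Qed.

Lemma U_ideal :
  \big[ideal_add/[set (0 : {mpoly k[n]})]%classic]_(0 <= t < (a - b).+1)
    ideal_mul (ideal_exp (var_ideal (J :\: K)) t) (ideal_exp (var_ideal (J :&: K)) (a - t)) =
  mon (Upart (a - b)).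
Proof.
under eq_bigr => t _ do rewrite ideal_expE (ideal_mul_expE _ (@upward_closed_mdeg_in _ _ _)
  (independent_of_mdeg_in _ disjointAC)).
rewrite big_ideal_addE; apply: eq_mon_ideal => m; rewrite /Upart -/dA -/dC.
apply/hasP/idP => [[t]|H]; first by rewrite mem_index_iota /=; lia.
(* The smallest [t] with [a - t <= dC m]. *)
by exists (a - dC m)%N; rewrite ?mem_index_iota /= -/dA -/dC; lia.
Qed.

Lemma V_ideal :
  \big[ideal_add/[set (0 : {mpoly k[n]})]%classic]_(1 <= t < b.+1)
    ideal_mul (ideal_mul (ideal_exp (var_ideal (K :\: J)) t)
                         (ideal_exp (var_ideal (J :\: K)) (a - b + t)))
              (ideal_exp (var_ideal (J :&: K)) (b - t)) =
  mon (Vpart b).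
Proof.
under eq_bigr => t _ do rewrite box_ideal.
rewrite big_ideal_addE; apply: eq_mon_ideal => m; rewrite /Vpart.
apply/hasP/idP => [[t]|H]; first by rewrite mem_index_iota /box; lia.
(* The smallest [t >= 1] with [b - t <= dC m]. *)
by exists (maxn 1 (b - dC m)); rewrite ?mem_index_iota /box; lia.
Qed.

(** A monomial of I with C-degree at least [b] lies in U; otherwise its B-degree is positive and its
    A-degree exceeds [a - b], which puts it in V. *)
Lemma I_ideal :
  (ideal_exp (var_ideal J) a `&` ideal_exp (var_ideal K) b)%classic =
  mon (predU (Upart (a - b)) (Vpart b)).
Proof.
rewrite !ideal_expE mon_idealI; apply: eq_mon_ideal => m /=.
rewrite /Upart /Vpart.
have -> : mdeg_in J m = (dC m + dA m)%N by rewrite /mdeg_in (big_setID K).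
have -> : mdeg_in K m = (dC m + dB m)%N by rewrite /mdeg_in (big_setID J) setIC.
by lia.
Qed.

Lemma W_ideal :
  ideal_mul (ideal_mul (var_ideal (K :\: J)) (ideal_exp (var_ideal (J :\: K)) (a - b + 1)))
            (ideal_exp (var_ideal (J :&: K)) b) = mon (box 1 (a - b + 1) b).
Proof. by rewrite -box_ideal [ideal_exp _ 1]ideal_expE -var_idealE. Qed.

End Decomposition.

Theorem theorem5p9 (k : fieldType) (n a b : nat) (J K : {set 'I_n})
    (hb : (1 <= b)%N) (hab : (b <= a)%N)
    (hC : J :&: K != set0) (hA : J :\: K != set0) (hB : K :\: J != set0) :
  let mA : set {mpoly k[n]} := var_ideal (J :\: K) in
  let mB : set {mpoly k[n]} := var_ideal (K :\: J) in
  let mC : set {mpoly k[n]} := var_ideal (J :&: K) in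
  let U : set {mpoly k[n]} := \big[ideal_add/[set 0%R]%classic]_(0 <= t < (a - b).+1)
             ideal_mul (ideal_exp mA t) (ideal_exp mC (a - t)) in
  let V : set {mpoly k[n]} := \big[ideal_add/[set 0%R]%classic]_(1 <= t < b.+1)
             ideal_mul (ideal_mul (ideal_exp mB t) (ideal_exp mA (a - b + t)))
                       (ideal_exp mC (b - t)) in
  let W : set {mpoly k[n]} := ideal_mul (ideal_mul mB (ideal_exp mA (a - b + 1)))
                     (ideal_exp mC b) in
  let I : set {mpoly k[n]} :=
    (ideal_exp (var_ideal J) a `&` ideal_exp (var_ideal K) b)%classic in
  forall i : nat,
  [/\ betti i (i + a) I = betti i (i + a) U,
      betti i (i + a + 1) I =
        (betti i (i + a + 1) V
         + (if i is i'.+1 then betti i' (i + a + 1) W else 0))%N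
    & forall j : nat, (2 <= j <= b)%N ->
        betti i (i + a + j) I = betti i (i + a + j) V].
Proof.
move=> mA mB mC U V W I i.
rewrite /U /V /W /I U_ideal // V_ideal // W_ideal I_ideal //.
(* [betti_UV] counts summands as [T.+1], so all [b] of them correspond to [b.-1]. *)
have [|resV _ bettiI] := @betti_UV k n a b J K hb hab b.-1; first by lia.
rewrite (prednK hb) in resV bettiI.
have resU : resolvable a a (@mon_ideal k n (Upart a J K (a - b))).
  by apply: resolvable_Upart; lia.
have resW : resolvable a.+2 a.+2 (@mon_ideal k n (box J K 1 (a - b + 1) b)).
  by apply: resolvable_box; lia.
(* W is linear in degree a + 2, so in homological degree i - 1 its only shift is i + a + 1. *)
have W0 j : j != 1%N ->
    (if i is i'.+1
     then betti i' (i + a + j) (@mon_ideal k n (box J K 1 (a - b + 1) b)) else 0) = 0%N.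
  by case: i => // i' j1; apply: (betti_eq0 resW); lia.
(* V vanishes in internal degree i + a, and U in every other one. *)
split=> [||j j2]; rewrite bettiI.
- have := W0 0%N isT; rewrite addn0 => ->.
  by rewrite addn0 (betti_eq0 (P := mon_ideal (Vpart _ _ _ _ _)) resV) ?addn0 //; lia.
- by rewrite (betti_eq0 resU) //; lia.
by rewrite W0 ?addn0 ?(betti_eq0 resU) //; lia.
Qed.
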